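(* Let $p$ be a prime and let $G$ be a metabelian $p$-group of coclass $1$ and order $p^m$, of nilpotency class $c=m-1\ge 2$ (so $m\ge 3$), with defect of commutativity $k$, where $k=0$ for $m\le 4$ and $0\le k\le m-4$ otherwise. Assume that $G$ is isomorphic to the representative $G_a^m(z,w)$ with integer parameters $0\le w,z,a(m-1),\ldots,a(m-k)<p$, and let $x,y$ be the normalized generators of $G$ satisfying the relations of this representative. Then the annihilator ideal $\mathfrak{A}=\mathfrak{A}(G)\unlhd\mathbb{Z}[X,Y]$ is $$\mathfrak{A}=\mathfrak{W}_{m-2}(a):=\left(X^{m-2},\ Y-\sum_{\ell=1}^k a(m-\ell)X^{m-2-\ell},\ \sum_{\ell=1}^p\binom{p}{\ell}X^{\ell-1}\right).$$ In particular, if $k=0$, that is, the family $a$ of parameters is empty, then $$\mathfrak{A}=\mathfrak{Y}_{m-2}:=\mathfrak{W}_{m-2}(\emptyset)=\left(X^{m-2},\ Y,\ \sum_{\ell=1}^p\binom{p}{\ell}X^{\ell-1}\right).$$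
   Context: Conventions: $[a,b]=a^{-1}b^{-1}ab$, $t^g=g^{-1}tg$. The lower central series is $\gamma_1(G)=G$, $\gamma_j(G)=[\gamma_{j-1}(G),G]$; $G'=\gamma_2(G)$; $m$ is the index of nilpotency ($\gamma_m(G)=1\ne\gamma_{m-1}(G)$); coclass $=\log_p|G|-$ class. Annihilator: for a finite metabelian group $G=\langle x,y\rangle$ put $s_2=[y,x]$. Conjugation makes the abelian group $G'$ a $\mathbb{Z}[G]$-module, $t^{bg+ch}=(t^g)^b(t^h)^c$ for $b,c\in\mathbb{Z}$, $g,h\in G$ (so $t^{x-1}=[t,x]$, $t^{y-1}=[t,y]$; the actions of $x$ and $y$ on $G'$ commute). The annihilator (with respect to $x,y$) is the ideal $\mathfrak{A}(G)=\{f\in\mathbb{Z}[X,Y]:s_2^{f(x-1,y-1)}=1\}$. Two-step centralizer: $\chi_2(G)=\{g\in G:[g,u]\in\gamma_4(G)\text{ for all }u\in\gamma_2(G)\}$. Normalized generators $x,y$: $x\in G\setminus\chi_2(G)$ if $m\ge4$, and $y\in\chi_2(G)\setminus\gamma_2(G)$. Put $s_j=[s_{j-1},x]$ for $j\ge 3$. The defect $k$ is defined by $[\chi_2(G),\gamma_2(G)]=\gamma_{m-k}(G)$; possible values are $k=0$ for $3\le m\le4$, $0\le k\le m-4$ for $m\ge5$, and $0\le k\le\min(m-4,p-2)$ for $m\ge p+1$ (Miech). Representative $G_a^m(z,w)$ (Miech), with $a=(a(m-k),\ldots,a(m-1))$ and $a(m-k)>0$ if $k\ge1$: the metabelian $p$-group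 of maximal class of order $p^m$ whose normalized generators satisfy $x^p=s_{m-1}^w$; $\ y^p\prod_{\ell=2}^p s_\ell^{\binom p\ell}=s_{m-1}^z$; $\ s_{j+1}^p\prod_{\ell=2}^p s_{j+\ell}^{\binom p\ell}=1$ for $1\le j\le m-2$; $\ [s_2,y]=\prod_{\ell=1}^k s_{m-\ell}^{a(m-\ell)}$; $\ s_j\ne1$ for $2\le j\le m-1$, $s_j=1$ for $j\ge m$, $\gamma_j(G)=\langle s_j,\gamma_{j+1}(G)\rangle$ with $\gamma_j(G)/\gamma_{j+1}(G)\simeq C_p$ for $2\le j\le m-1$; $\ [s_i,s_j]=1$ for $i,j\ge2$. *)

(* Defs.v *)
From HB Require Import structures.
From mathcomp Require Import all_boot all_order all_algebra.
From mathcomp Require Import all_fingroup all_solvable.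
From mathcomp.multinomials Require Export mpoly.

Set Implicit Arguments.
Unset Strict Implicit.
Unset Printing Implicit Defensive.

Import GRing.Theory.

Local Open Scope ring_scope.

(* The integral group ring.  The alias is needed because {ffun gT -> int}
   already carries the pointwise product; here the product is convolution. *)
Definition zgroup_ring (gT : finGroupType) : Type := {ffun gT -> int}.

Section ZGroupRing.
Variable gT : finGroupType.

HB.instance Definition _ := GRing.Zmodule.copy (zgroup_ring gT) {ffun gT -> int}.

Definition zgr_elt (g : gT) : zgroup_ring gT :=
  [ffun h : gT => (h == g)%:R : int].

Definition zgr_mul (a b : zgroup_ring gT) : zgroup_ring gT :=
  [ffun g : gT => \sum_(h : gT) (a : {ffun _}) h * (b : {ffun _}) (h^-1 * g)%g].

Fact zgr_mulA : associative zgr_mul.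
Proof.
move=> a b c; apply/ffunP=> g; rewrite !ffunE.
under eq_bigr => h _ do rewrite ffunE mulr_sumr.
under [in RHS]eq_bigr => h _ do rewrite ffunE mulr_suml.
rewrite [RHS]exchange_big /=; apply: eq_bigr => h _.
rewrite [RHS](reindex_inj (mulgI h)) /=; apply: eq_bigr => u _.
by rewrite mulKg mulrA invMg mulgA.
Qed.

Fact zgr_mul1l : left_id (zgr_elt 1%g) zgr_mul.
Proof.
move=> a; apply/ffunP=> g; rewrite ffunE (bigD1 1%g) //= big1 => [|h nh].
  by rewrite ffunE eqxx mul1r invg1 mul1g addr0.
by rewrite ffunE (negPf nh) mul0r.
Qed.

Fact zgr_mul1r : right_id (zgr_elt 1%g) zgr_mul.
Proof.
move=> a; apply/ffunP=> g; rewrite ffunE (bigD1 g) //= big1 => [|h nh].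
  by rewrite ffunE mulVg eqxx mulr1 addr0.
by rewrite ffunE -eq_mulVg1 (negPf nh) mulr0.
Qed.

Fact zgr_mulDl : left_distributive zgr_mul +%R.
Proof.
move=> a b c; apply/ffunP=> g; rewrite !ffunE -big_split /=.
by apply: eq_bigr => h _; rewrite ffunE mulrDl.
Qed.

Fact zgr_mulDr : right_distributive zgr_mul +%R.
Proof.
move=> a b c; apply/ffunP=> g; rewrite !ffunE -big_split /=.
by apply: eq_bigr => h _; rewrite ffunE mulrDr.
Qed.

Fact zgr_1neq0 : zgr_elt 1%g != 0.
Proof. by apply/eqP=> /ffunP/(_ 1%g); rewrite !ffunE eqxx. Qed.

HB.instance Definition _ := GRing.Zmodule_isNzRing.Build (zgroup_ring gT)
  zgr_mulA zgr_mul1l zgr_mul1r zgr_mulDl zgr_mulDr zgr_1neq0.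

End ZGroupRing.

Definition zexpg (gT : finGroupType) (t : gT) (c : int) : gT :=
  match c with Posz n => (t ^+ n)%g | Negz n => (t ^- n.+1)%g end.

(* t^r for t in the abelian normal subgroup G' and r supported in G.  The
   factors commute, so the order of enumeration of G is irrelevant. *)
Definition zgr_act (gT : finGroupType) (G : {group gT}) (t : gT)
    (r : zgroup_ring gT) : gT :=
  (\prod_(g in G) zexpg (t ^ g) ((r : {ffun _}) g))%g.

(* Z[X,Y], with X of index 0 and Y of index 1. *)
Notation ZXY := {mpoly int[2]}.
Definition mX : ZXY := 'X_ord0.
Definition mY : ZXY := 'X_ord_max.

(* f(x-1,y-1).  As x and y need not commute, each monomial X^i Y^j is read as
   (x-1)^i (y-1)^j; the other orders act in the same way on G'. *)
Definition eval_xy (gT : finGroupType) (x y : gT) (f : ZXY) : zgroup_ring gT :=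
  mmap (fun c : int => c%:~R)
    (fun i : 'I_2 => if i == ord0 then zgr_elt x - 1 else zgr_elt y - 1) f.

(* The sequence s_2 = [y,x], s_j = [s_(j-1),x]; meaningful only for j >= 2. *)
Definition sgen (gT : finGroupType) (x y : gT) (j : nat) : gT :=
  iter (j - 2) (fun t => [~ t, x]%g) [~ y, x]%g.

Definition annihilator (gT : finGroupType) (G : {group gT}) (x y : gT)
    (f : ZXY) : Prop :=
  zgr_act G (sgen x y 2) (eval_xy x y f) = 1%g.

Definition ideal_gen (R : comNzRingType) (gs : seq R) (f : R) : Prop :=
  exists c : nat -> R, f = \sum_(i < size gs) c i * gs`_i.

(* The ideal W_(m-2)(a), for the family a = (a(m-k),...,a(m-1)); the other
   values of a are not used. *)
Definition idealW (p m k : nat) (a : nat -> nat) : ZXY -> Prop :=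
  ideal_gen [:: mX ^+ (m - 2);
                mY - \sum_(1 <= l < k.+1) mX ^+ (m - 2 - l) *+ a (m - l)%N;
                \sum_(1 <= l < p.+1) mX ^+ (l - 1) *+ 'C(p, l)].

(* The ideal Y_(m-2): W_(m-2) of the empty family (k = 0). *)
Definition idealY (p m : nat) : ZXY -> Prop := idealW p m 0 (fun _ => 0%N).

Local Close Scope ring_scope.
Local Open Scope group_scope.

Definition metabelian (gT : finGroupType) (G : {group gT}) : bool :=
  abelian G^`(1).

Definition coclass (gT : finGroupType) (p : nat) (G : {group gT}) : nat :=
  logn p #|G| - nil_class G.

Definition chi2 (gT : finGroupType) (G : {group gT}) : {set gT} :=
  [set g in G | [forall u in 'L_2(G), [~ g, u] \in 'L_4(G)]].

Definition has_defect (gT : finGroupType) (G : {group gT}) (m k : nat) : Prop :=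
  [~: chi2 G, 'L_2(G)] = 'L_(m - k)(G).

Definition normalized_generators (gT : finGroupType) (G : {group gT}) (m : nat)
    (x y : gT) : Prop :=
  [/\ <<[set x; y]>> = G,
      x \in G,
      4 <= m -> x \notin chi2 G
    & y \in chi2 G :\: 'L_2(G)].

Record miech_relations (gT : finGroupType) (G : {group gT}) (p m k : nat)
    (a : nat -> nat) (z w : nat) (x y : gT) : Prop := MiechRelations {
  miech_x : x ^+ p = sgen x y (m - 1) ^+ w;
  miech_y : y ^+ p * \prod_(2 <= l < p.+1) sgen x y l ^+ 'C(p, l)
            = sgen x y (m - 1) ^+ z;
  miech_s : forall j, 1 <= j <= m - 2 ->
            sgen x y j.+1 ^+ p *
              \prod_(2 <= l < p.+1) sgen x y (j + l) ^+ 'C(p, l) = 1;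
  miech_s2y : [~ sgen x y 2, y]
              = \prod_(1 <= l < k.+1) sgen x y (m - l) ^+ a (m - l);
  miech_s_neq1 : forall j, 2 <= j <= m - 1 -> sgen x y j != 1;
  miech_s_eq1 : forall j, m <= j -> sgen x y j = 1;
  miech_lcn_gen : forall j, 2 <= j <= m - 1 ->
                  'L_j(G) = <<sgen x y j |: 'L_j.+1(G)>>;
  miech_lcn_quo : forall j, 2 <= j <= m - 1 ->
                  'L_j(G) / 'L_j.+1(G) \isog Zp p;
  miech_s_comm : forall i j, 2 <= i -> 2 <= j -> [~ sgen x y i, sgen x y j] = 1
}.

(* G, with x and y, is the representative G_a^m(z,w): being isomorphic to it
   amounts to having normalized generators that satisfy its relations. *)
Record is_miech_rep (gT : finGroupType) (G : {group gT}) (p m k : nat)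
    (a : nat -> nat) (z w : nat) (x y : gT) : Prop := IsMiechRep {
  rep_w : w < p;
  rep_z : z < p;
  rep_a : forall l, 1 <= l <= k -> a (m - l) < p;
  rep_a_pos : 1 <= k -> 0 < a (m - k);
  rep_gens : normalized_generators G m x y;
  rep_rels : miech_relations G p m k a z w x y
}.

(* Main.v *)
From HB Require Import structures.
Require Import Defs.
From mathcomp Require Import all_boot all_order all_algebra.
From mathcomp Require Import all_fingroup all_solvable.
From mathcomp Require Import ring zify.

(** The derived subgroup of [G] is abelian, so conjugation by [x] and by [y]
    commute on it, and [X], [Y] acting as [t |-> [~ t, x]], [t |-> [~ t, y]]
    turn it into a Z[X,Y]-module ([polyactM]); the annihilator of [s_2] in this
    module is therefore an ideal ([annihilatorE], [act_ideal]).  As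
    [X ^ i] sends [s_2] to [s_(i+2)] ([fmval_act_Xn]), the three generators of
    [W = W_(m-2)(a)] annihilate [s_2] because of the relations [s_m = 1], the
    one giving [[s_2, y]], and the one giving [s_2 ^ p].  This is the easy
    inclusion.

    For the converse, modulo [W] both [Y] and [p] are multiples of [X]
    ([idealW_Y], [idealW_p]), so [Z[X,Y] / (W, X)] is a quotient of [Z/p], and
    every [f] is congruent to [c X^j] plus a multiple of [X^(j+1)] as soon as
    it is a multiple of [X^j].  If [f] annihilates [s_2], then
    [s_(j+2) ^ c] is in [gamma_(j+3)], because [X] moves
    every term of the lower central series into the next one; since
    [gamma_(j+2) / gamma_(j+3)] has order [p] and is generated by [s_(j+2)],
    this makes [p] divide [c] ([sgen_power]), so that [c X^j] is congruent to
    a multiple of [X^(j+1)] as well.  Climbing in this way, [f] is congruent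
    modulo [W] to a multiple of [X^(m-2)], which is in [W]
    ([act_kernel_reduce]). *)

Set Implicit Arguments.
Unset Strict Implicit.
Unset Printing Implicit Defensive.

Import GRing.Theory.

Import FiniteModule.

(** * Ideals given by a list of generators *)

Section IdealGen.
Local Open Scope ring_scope.

Variables (R : comNzRingType) (gs : seq R).

Lemma ideal_genD f g : ideal_gen gs f -> ideal_gen gs g -> ideal_gen gs (f + g).
Proof.
move=> [c ->] [d ->]; exists (fun i => c i + d i).
by rewrite -big_split /=; apply: eq_bigr => i _; rewrite mulrDl.
Qed.

Lemma ideal_genMl r f : ideal_gen gs f -> ideal_gen gs (r * f).
Proof.
move=> [c ->]; exists (fun i => r * c i).
by rewrite mulr_sumr; apply: eq_bigr => i _; rewrite mulrA.
Qed.

Lemma ideal_gen_nth i : (i < size gs)%N -> ideal_gen gs gs`_i.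
Proof.
move=> lt_i; exists (fun j => (j == i)%:R).
rewrite (bigD1 (Ordinal lt_i)) //= eqxx mul1r big1 ?addr0 // => j ne_ji.
by rewrite -[_ == i]/(j == Ordinal lt_i) (negPf ne_ji) mul0r.
Qed.

End IdealGen.

(** * The derived subgroup as a Z[X,Y]-module *)

Section GroupRingAction.
Local Open Scope ring_scope.

Variables (gT : finGroupType) (G : {group gT}) (metaG : abelian G^`(1)).

Local Notation M := (fmod_of metaG).
Implicit Types (u v : M) (g x y : gT) (r : zgroup_ring gT).

(** [zgr_act], written additively in the Z-module [M] of the derived subgroup:
    unlike products in [gT], sums in [M] can be reordered. *)
Definition zact u r : M := \sum_(g in G) (u ^@ g) *~ (r : {ffun _}) g.

Lemma zact_is_zmod_morphism u : zmod_morphism (zact u).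
Proof.
move=> r s; rewrite /zact -sumrB; apply: eq_bigr => g _.
by rewrite !ffunE mulrzBr.
Qed.

HB.instance Definition _ (u : M) :=
  GRing.isZmodMorphism.Build (zgroup_ring gT) M (zact u)
    (zact_is_zmod_morphism u).

Lemma fmval_zexpg u (c : int) : fmval (u *~ c) = zexpg (fmval u) c.
Proof.
case: c => n; first exact: fmvalZ.
by rewrite NegzE mulrNz -pmulrn [fmval _]fmvalN; congr (_^-1)%g; apply: fmvalZ.
Qed.

Lemma norm_der1 g : g \in G -> g \in 'N(G^`(1))%g.
Proof. exact: (subsetP (der_norm 1 G)). Qed.

Lemma fmval_zact u r : fmval (zact u r) = zgr_act G (fmval u) r.
Proof.
rewrite /zact fmval_sum; apply: eq_bigr => g Gg.
by rewrite fmval_zexpg fmvalJ ?norm_der1.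
Qed.

Lemma zact1 u : zact u 1 = u.
Proof.
rewrite /zact (bigD1 1%g) //= big1 ?addr0 => [|g /andP[_ ne_g1]].
  by rewrite ffunE eqxx actr1.
by rewrite ffunE (negPf ne_g1).
Qed.

Lemma actMzr g u (c : int) : (u *~ c) ^@ g = (u ^@ g) *~ c.
Proof.
by case: c => n; rewrite ?NegzE ?mulrNz ?actNr ?(actZr g n) // (actZr g n.+1).
Qed.

(** The translation [h |-> h * g] permutes [G], so values of [r] outside [G]
    never enter the sum defining [zact]. *)
Lemma zactM_elt u r g : g \in G -> zact u (r * zgr_elt g) = zact u r ^@ g.
Proof.
move=> Gg; rewrite /zact (actr_sum g).
rewrite (reindex_inj (mulIg g)) /=; apply: eq_big => [h | h]; rewrite groupMr //.
move=> Gh; have -> : (r * zgr_elt g : {ffun _}) (h * g)%g = (r : {ffun _}) h.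
  rewrite ffunE (bigD1 h) //= big1 ?addr0 => [|j ne_jh].
    by rewrite ffunE mulKg eqxx mulr1.
  rewrite ffunE mulgA.
  by rewrite -{2}[g]mul1g (inj_eq (mulIg g)) -eq_mulVg1 (negPf ne_jh) mulr0.
by rewrite actrM ?norm_der1 // actMzr.
Qed.

Definition delta g u : M := u ^@ g - u.

Lemma delta_is_zmod_morphism g : zmod_morphism (delta g).
Proof.
by move=> u v; rewrite /delta actAr actNr !opprD !opprK addrACA.
Qed.

HB.instance Definition _ g :=
  GRing.isZmodMorphism.Build M M (delta g) (delta_is_zmod_morphism g).

Lemma fmval_delta u g : g \in G -> fmval (delta g u) = [~ fmval u, g]%g.
Proof.
move=> Gg; rewrite /delta addrC fmvalA [val (- u)]fmvalN.
by rewrite [val (u ^@ g)]fmvalJ ?norm_der1.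
Qed.

(** Here [G] has to be metabelian: [y * x] and [x * y] differ by an element
    of the derived subgroup, which centralises the module. *)
Lemma delta_comm x y u : x \in G -> y \in G ->
  delta x (delta y u) = delta y (delta x u).
Proof.
move=> Gx Gy; rewrite /delta !actAr !actNr !opprD !opprK !addrA; congr (_ + _).
rewrite -!(addrA (_ ^@ _ ^@ _)) [- _ - _]addrC; congr (_ + _).
rewrite -!actrM ?norm_der1 //; apply: fmod_inj.
rewrite !fmvalJ ?groupM ?norm_der1 //.
rewrite (commgC y x) conjgM.
suff cent_u: (fmval u ^ (x * y) \in G^`(1))%g.
  by rewrite [LHS]conjgE (centsP metaG _ cent_u) ?mulKg // mem_commg.
by rewrite memJ_norm ?fmodP // groupM ?norm_der1.
Qed.

Lemma zactM_delta n u r g : g \in G ->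
  zact u (r * (zgr_elt g - 1) ^+ n) = iter n (delta g) (zact u r).
Proof.
move=> Gg; elim: n => [|n IHn] /=; first by rewrite expr0 mulr1.
by rewrite exprSr mulrA -IHn mulrBr mulr1 raddfB /= zactM_elt.
Qed.

Lemma fmval_iter_delta n i u g : g \in G ->
  fmval u \in 'L_n(G)%g -> fmval (iter i (delta g) u) \in 'L_(n + i)(G)%g.
Proof.
move=> Gg Lu; elim: i => [|i IHi] /=; first by rewrite addn0.
by rewrite addnS fmval_delta // (subsetP (lcnSnS _ _)) // mem_commg.
Qed.

Variables x y : gT.
Hypotheses (Gx : x \in G) (Gy : y \in G).

Definition polyact u (f : ZXY) : M := zact u (eval_xy x y f).

Lemma polyact_is_zmod_morphism u : zmod_morphism (polyact u).
Proof.
move=> f g; rewrite /polyact /eval_xy -[fun c : int => _]/(intmul 1).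
by rewrite mmapB raddfB.
Qed.

HB.instance Definition _ (u : M) :=
  GRing.isZmodMorphism.Build ZXY M (polyact u) (polyact_is_zmod_morphism u).

Lemma polyact_monomial u c m :
  polyact u (c *: 'X_[m]) =
    iter (m ord_max) (delta y) (iter (m ord0) (delta x) u) *~ c.
Proof.
rewrite /polyact /eval_xy -[fun c : int => _]/(intmul 1) mmapZ /= mulrzl.
rewrite mmapX /mmap1 !big_ord_recl big_ord0 mulr1 raddfMz /=.
rewrite (_ : lift ord0 ord0 = ord_max); last exact: val_inj.
by rewrite zactM_delta // -[_ ^+ m ord0]mul1r zactM_delta // zact1.
Qed.

Lemma mpolyX2E (m : 'X_{1..2}) : 'X_[m] = mX ^+ m ord0 * mY ^+ m ord_max.
Proof.
rewrite mpolyXE_id !big_ord_recl big_ord0 mulr1.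
by rewrite (_ : lift ord0 ord0 = ord_max) //; exact: val_inj.
Qed.

Lemma iter_delta_comm i j u :
  iter j (delta y) (iter i (delta x) u) = iter i (delta x) (iter j (delta y) u).
Proof.
have comm1 v: delta y (iter i (delta x) v) = iter i (delta x) (delta y v).
  by elim: i => //= i IHi; rewrite delta_comm // IHi.
by elim: j => //= j ->.
Qed.

Lemma polyactMX u f : polyact u (f * mX) = delta x (polyact u f).
Proof.
elim/mpolyind: f => [|c m f _ _ IHf]; first by rewrite mul0r !raddf0.
rewrite mulrDl !raddfD /= IHf -scalerAl -mpolyXD !polyact_monomial raddfMz /=.
rewrite !mnmDE !mnm1E addn0 addn1 /=; congr (_ *~ _ + _).
exact: (iter_delta_comm 1 _ (iter _ (delta x) u)).
Qed.

Lemma polyactMY u f : polyact u (f * mY) = delta y (polyact u f).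
Proof.
elim/mpolyind: f => [|c m f _ _ IHf]; first by rewrite mul0r !raddf0.
rewrite mulrDl !raddfD /= IHf -scalerAl -mpolyXD !polyact_monomial raddfMz /=.
by rewrite !mnmDE !mnm1E addn0 addn1.
Qed.

Lemma polyactMXn u f i : polyact u (f * mX ^+ i) = iter i (delta x) (polyact u f).
Proof.
by elim: i => [|i IHi]; rewrite ?expr0 ?mulr1 // exprSr mulrA polyactMX IHi.
Qed.

(** The module law.  It does not follow from multiplicativity of [eval_xy],
    which fails when [x] and [y] do not commute; it holds because their actions
    commute, which allows a factor [X] to be moved past the powers of [Y]. *)
Lemma polyactM u (f h : ZXY) : polyact u (f * h) = polyact (polyact u f) h.
Proof.
elim/mpolyind: h => [|c m h _ _ IHh]; first by rewrite mulr0 !raddf0.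
rewrite mulrDr !raddfD /= IHh polyact_monomial; congr (_ + _).
rewrite -scalerAr -[c]intz scaler_int raddfMz /= intz; congr (_ *~ c).
rewrite mpolyX2E mulrA -polyactMXn.
elim: (m ord_max) => [|j IHj]; first by rewrite expr0 mulr1.
by rewrite exprSr mulrA polyactMY IHj.
Qed.

Lemma polyact1 u : polyact u 1 = u.
Proof.
by rewrite -[1]scale1r -mpolyX0 polyact_monomial !mnm0E.
Qed.

Lemma polyact0 f : polyact 0 f = 0.
Proof.
by rewrite /polyact /zact big1 // => g _; rewrite act0r mul0rz.
Qed.

End GroupRingAction.

(** * Ingredients of the descent along powers of X *)

Section Residues.
Local Open Scope ring_scope.

(** This isolates the constant term of a cofactor, the only part of it that the
    relations of [W] do not directly push into a higher power of [X]. *)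
Lemma ZXY_residue (f : ZXY) :
  exists c : int, exists q1 q2 : ZXY, f = c%:~R + q1 * mX + q2 * mY.
Proof.
elim/mpolyind: f => [|c m f _ _ [d [q1 [q2 ->]]]].
  by exists 0, 0, 0; rewrite !mul0r !addr0.
rewrite -[c]intz scaler_int mpolyX2E.
case: (m ord0) (m ord_max) => [|i] [|j].
- by exists (c + d), q1, q2; rewrite !expr0; ring.
- by exists d, q1, (q2 + mY ^+ j *~ c); rewrite expr0 exprSr; ring.
- by exists d, (q1 + mX ^+ i *~ c), q2; rewrite expr0 exprSr; ring.
- exists d, (q1 + (mX ^+ i * mY ^+ j.+1) *~ c), q2.
  by rewrite [mX ^+ _]exprSr; ring.
Qed.

Lemma sum_X_factor (s e : nat) (d b : nat -> nat) :
  (forall l, s <= l < e -> 0 < d l)%N ->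
  \sum_(s <= l < e) mX ^+ d l *+ b l =
    (\sum_(s <= l < e) mX ^+ (d l).-1 *+ b l) * mX.
Proof.
move=> d_gt0; rewrite mulr_suml; apply: eq_big_nat => l /d_gt0 dl_gt0.
by rewrite mulrnAl -exprSr prednK.
Qed.

Lemma sgenE (gT : finGroupType) (x y : gT) i :
  sgen x y i.+2 = iter i (fun t => [~ t, x]%g) [~ y, x]%g.
Proof. by rewrite /sgen !subSS subn0. Qed.

(** A generator of [H] modulo [K] has order exactly [p] there. *)
Lemma dvdn_prime_index (gT : finGroupType) (H K : {group gT}) (p n : nat) s :
  prime p -> (K <| H)%g -> (H :=: <<s |: K>>)%g -> (H / K \isog Zp p)%g ->
  (s ^+ n)%g \in K -> (p %| n)%N.
Proof.
move=> p_pr nsKH defH isoHK Ksn.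
have oHK : #|(H / K)%g| = p.
  by rewrite (card_isog isoHK) card_Zp // prime_gt0.
have Hs : s \in H by rewrite defH mem_gen // setU11.
have Ns : s \in 'N(K)%g by rewrite (subsetP (normal_norm nsKH)).
have dvd_os : (#[coset K s]%g %| p)%N by rewrite -oHK order_dvdG ?mem_quotient.
case/primeP: p_pr => p_gt1 /(_ _ dvd_os) /pred2P[os1 | <-]; last first.
  by rewrite order_dvdn -morphX //=; apply/eqP/coset_id.
have Ks : s \in K.
  by apply: coset_idr => //; apply/eqP; rewrite -order_eq1 os1.
have HK : (H / K = 1)%g.
  apply/trivgP; rewrite quotient_sub1 ?normal_norm //.
  by rewrite defH gen_subG subUset sub1set Ks subxx.
by rewrite -oHK HK cards1 in p_gt1.
Qed.

End Residues.

(** * The annihilator of [s_2] *)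

Section Annihilator.
Local Open Scope ring_scope.

Variables (gT : finGroupType) (G : {group gT}) (p m k z w : nat).
Variables (a : nat -> nat) (x y : gT).
Hypotheses (p_prime : prime p) (metaG : abelian G^`(1)).
Hypotheses (m_ge3 : (3 <= m)%N).
Hypotheses (k_bound : (0 < k -> k + 4 <= m)%N).
Hypotheses (Gx : x \in G) (Gy : y \in G).
Hypothesis relG : miech_relations G p m k a z w x y.

Local Notation s2 := (fmod metaG [~ y, x]%g).
Local Notation act := (polyact x y).

Lemma fmval_s2 : fmval s2 = sgen x y 2.
Proof. exact: (fmodK metaG (mem_commg Gy Gx)). Qed.

Lemma annihilatorE f : annihilator G x y f <-> act s2 f = 0.
Proof.
rewrite /annihilator -fmval_s2 -(fmval_zact (metaG := metaG)).
rewrite -[zact _ _]/(act s2 f).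
by split=> [E | ->] //; apply: fmod_inj.
Qed.

Lemma fmval_act_Xn i : fmval (act s2 (mX ^+ i)) = sgen x y i.+2.
Proof.
rewrite -[mX ^+ i]mul1r polyactMXn // polyact1 // sgenE.
by elim: i => [|i IHi]; [exact: fmval_s2 | rewrite /= fmval_delta // IHi].
Qed.

Lemma fmval_act_sum_X (s e : nat) (d b : nat -> nat) :
  fmval (act s2 (\sum_(s <= l < e) mX ^+ d l *+ b l)) =
    (\prod_(s <= l < e) sgen x y (d l).+2 ^+ b l)%g.
Proof.
rewrite raddf_sum /= fmval_sum; apply: eq_bigr => l _.
by rewrite raddfMn [LHS]fmvalZ /= [val _]fmval_act_Xn.
Qed.

Lemma act_Xn_filtration i f : fmval (act s2 (f * mX ^+ i)) \in 'L_i.+2(G)%g.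
Proof.
by rewrite polyactMXn // -add2n fmval_iter_delta // fmodP.
Qed.

(** One generator at a time: [s_m = 1], the relation for [[s_2, y]], and the
    relation for [s_(j+1) ^ p] at [j = 1]. *)
Lemma act_ideal f : idealW p m k a f -> act s2 f = 0.
Proof.
case=> c ->; rewrite raddf_sum big1 // => -[i /= lt_i3] _.
rewrite mulrC polyactM //; set g := _`_i.
suff -> : act s2 g = 0 by exact: polyact0.
rewrite {}/g; case: i lt_i3 => [|[|[|//]]] _ /=.
- apply: fmod_inj; rewrite fmval_act_Xn (miech_s_eq1 relG) //; lia.
- rewrite raddfB /=; apply/eqP; rewrite subr_eq0; apply/eqP/fmod_inj.
  rewrite fmval_act_sum_X -[mY]mul1r polyactMY // polyact1 // fmval_delta //.
  rewrite fmval_s2 (miech_s2y relG); apply: eq_big_nat => l lb.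
  by congr (sgen x y _ ^+ _)%g; lia.
- apply: fmod_inj; rewrite fmval_act_sum_X.
  have m2_gt0 : (1 <= 1 <= m - 2)%N by lia.
  apply: etrans (miech_s relG m2_gt0).
  rewrite big_ltn ?ltnS ?prime_gt0 // bin1; congr (_ * _)%g.
  by apply: eq_big_nat => l lb; congr (sgen x y _ ^+ _)%g; lia.
Qed.

(** The bound on the defect makes every exponent [m - 2 - l], [1 <= l <= k],
    positive, hence the factor [X]. *)
Lemma idealW_Y : exists q, idealW p m k a (mY - q * mX).
Proof.
exists (\sum_(1 <= l < k.+1) mX ^+ (m - 2 - l).-1 *+ a (m - l)%N).
rewrite -sum_X_factor; last by move=> l; lia.
exact: (ideal_gen_nth (gs := [:: _; _; _]) (i := 1)).
Qed.

(** The third generator has constant term ['C(p, 1)], that is [p]. *)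
Lemma idealW_p : exists r, idealW p m k a (p%:~R - r * mX).
Proof.
exists (- \sum_(2 <= l < p.+1) mX ^+ (l - 1).-1 *+ 'C(p, l)).
rewrite mulNr opprK -sum_X_factor; last by move=> l; lia.
have <- : \sum_(1 <= l < p.+1) mX ^+ (l - 1) *+ 'C(p, l) =
    p%:~R + \sum_(2 <= l < p.+1) mX ^+ (l - 1) *+ 'C(p, l) :> ZXY.
  by rewrite big_ltn ?ltnS ?prime_gt0 // bin1 subnn expr0 -pmulrn.
exact: (ideal_gen_nth (gs := [:: _; _; _]) (i := 2)).
Qed.

(** This is where maximality of the class enters: the factors of the lower
    central series have prime order, so [s_(j+2)] has order [p] modulo the next
    term. *)
Lemma sgen_power j (c : int) : (j < m - 2)%N ->
  fmval (act s2 (mX ^+ j) *~ c) \in 'L_(j.+3)(G)%g -> exists d, c = d * p%:Z.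
Proof.
move=> lt_jm Lc; have jb : (2 <= j.+2 <= m - 1)%N by lia.
suff /dvdnP[d dE] : (p %| `|c|)%N.
  exists (sgz c * d%:Z); rewrite {1}[c]intEsg dE; lia.
apply: (dvdn_prime_index (H := [group of 'L_(j.+2)(G)]%g)
  (K := [group of 'L_(j.+3)(G)]%g) (s := sgen x y j.+2) p_prime).
- exact: lcn_normalS.
- exact: (miech_lcn_gen relG).
- exact: (miech_lcn_quo relG).
case: c Lc => n.
  by rewrite -pmulrn [fmval _]fmvalZ [val _]fmval_act_Xn.
rewrite NegzE mulrNz -pmulrn [fmval _]fmvalN groupV.
by rewrite [val _]fmvalZ [val _]fmval_act_Xn.
Qed.

(** The descent: each step trades [c X^j], with [c] divisible by [p], for a
    multiple of [X^(j+1)]. *)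
Lemma act_kernel_reduce f j : act s2 f = 0 -> (j <= m - 2)%N ->
  exists h, idealW p m k a (f - h * mX ^+ j).
Proof.
move=> f0; elim: j => [|j IHj] lt_jm.
  exists f; rewrite expr0 mulr1 subrr.
  by exists (fun=> 0); rewrite big1 // => i _; rewrite mul0r.
have [h Wh] := IHj (ltnW lt_jm).
have [c [q1 [q2 hE]]] := ZXY_residue h.
have [q Wq] := idealW_Y; have [r Wr] := idealW_p.
(* Y is replaced by q X in the last term of h. *)
have {hE}Wc : idealW p m k a
    (f - (c%:~R * mX ^+ j + (q1 + q2 * q) * mX ^+ j.+1)).
  have := ideal_genD Wh (ideal_genMl (q2 * mX ^+ j) Wq).
  by congr (idealW _ _ _ _ _); rewrite hE exprS; ring.
have [d cE] : exists d, c = d * p%:Z.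
  apply: (sgen_power lt_jm).
  have /eqP := act_ideal Wc.
  rewrite raddfB /= f0 sub0r oppr_eq0 raddfD /= mulrzl raddfMz /= addr_eq0.
  move=> /eqP ->; rewrite [fmval _]fmvalN groupV.
  exact: act_Xn_filtration.
(* p is replaced by r X in c X^j = d p X^j. *)
exists (d%:~R * r + q1 + q2 * q).
have := ideal_genD Wc (ideal_genMl (d%:~R * mX ^+ j) Wr).
congr (idealW _ _ _ _ _); rewrite cE rmorphM /= exprS.
by set P := p%:~R; ring.
Qed.

Lemma annihilator_idealW f : annihilator G x y f <-> idealW p m k a f.
Proof.
rewrite annihilatorE; split=> [f0 | /act_ideal //].
have [h Wh] := act_kernel_reduce f0 (leqnn (m - 2)).
rewrite -[f](subrK (h * mX ^+ (m - 2))).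
by apply: ideal_genD Wh _; apply: ideal_genMl;
   apply: (ideal_gen_nth (gs := [:: _; _; _]) (i := 0)).
Qed.

End Annihilator.

Unset Implicit Arguments.

Theorem theorem5p1 (gT : finGroupType) (G : {group gT}) (p m k z w : nat)
    (a : nat -> nat) (x y : gT)
    (p_prime : prime p) (pG : (p.-group G)%g) (metaG : metabelian G)
    (coclassG : coclass p G = 1) (oG : #|G| = p ^ m)
    (m_ge3 : 3 <= m) (classG : nil_class G = m - 1)
    (k_small : m <= 4 -> k = 0) (k_large : 4 < m -> k <= m - 4)
    (defectG : has_defect G m k)
    (repG : is_miech_rep G p m k a z w x y) :
  (forall f : ZXY, annihilator G x y f <-> idealW p m k a f) /\
  (k = 0 -> forall f : ZXY,
     (annihilator G x y f <-> idealY p m f) /\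
     (idealY p m f <->
        ideal_gen [:: mX ^+ (m - 2); mY;
                      \sum_(1 <= l < p.+1) mX ^+ (l - 1) *+ 'C(p, l)]%R f)).
Proof.
case: repG => _ _ _ _ [_ Gx _ /setDP[/setIdP[Gy _] _]] relG.
have k_bound : 0 < k -> k + 4 <= m by lia.
have annE f : annihilator G x y f <-> idealW p m k a f.
  exact: (annihilator_idealW p_prime metaG m_ge3 k_bound Gx Gy relG).
split=> // k0 f; rewrite annE k0 /idealY /idealW.
by rewrite !(big_geq (leqnn 1)) subr0.
Qed.
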